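(* For integers $0\le k\le m$, $$P_{m,k}=\det\left(h_{m-k-i+2j-1}(\{1,q\}^{i-j+2})\right)_{i,j\in\{0,1,\dots,k-1\}},$$ and this equals the weighted count (sum of weights) of families of $k$ pairwise non-intersecting lattice paths with unit north and east steps, the $j$-th path ($j=0,\dots,k-1$) going from $(2j,-2j)$ to $(2j+3,m-k-1-j)$, where a vertical step with even $x$-coordinate has weight $q$, all other steps have weight $1$, and the weight of a family is the product of the weights of all its steps.
   Context: $q$ is an indeterminate, $[k]=\frac{1-q^k}{1-q}$, $[k]!=\prod_{i=1}^k[i]$. For integers $j$ and $r\ge 1$, $h_j(\{1,q\}^r)$ is the complete homogeneous symmetric polynomial of degree $j$ in $2r$ variables, $r$ specialised to $q$ and $r$ to $1$; it is $0$ for $j<0$ (and is taken to be $0$ when $r\le 0$, $j\neq 0$ ... entries with $i-j+2\le 0$ do not arise as nonzero). The determinant of a $0\times 0$ matrix is $1$. For $m,n\in\mathbb{N}$ let $S_{m,n}(q)=\sum_{k=1}^{n}\frac{[2k]}{[2]}[k]^{m-1}q^{\frac{m+1}{2}(n-k)}$. The polynomials $P_{m,k}\in\mathbb{Z}[q]$ ($0\le k\le m$) are the $q$-Faulhaber polynomials of Guo and Zeng, i.e. those for which, for all $m\ge0$ and $n\ge1$, $$S_{2m+1,n}(q)=\sum_{k=0}^m(-1)^{m-k}\frac{[k]!}{[m+1]!}P_{m,m-k}\,q^{(m-k)n}\frac{([n][n+1])^{k+1}}{[2]}.$$ *)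

(* Defs.v *)
From HB Require Import structures.
From mathcomp Require Import all_boot all_order all_algebra.
From mathcomp Require Import fraction zify.

Set Implicit Arguments.
Unset Strict Implicit.
Unset Printing Implicit Defensive.

Import Order.TTheory GRing.Theory Num.Theory.
Local Open Scope ring_scope.

(* The indeterminate q is 'X in {poly int}.  Identities with denominators are
   stated in the fraction field. *)
Notation Zq := {poly int}.
Notation Fq := {fraction {poly int}}.

Definition qF : Fq := tofrac ('X : Zq).

Definition qint (k : nat) : Fq := (1 - qF ^+ k) / (1 - qF).

Definition qfact (k : nat) : Fq := \prod_(1 <= i < k.+1) qint i.

(* qS_odd m n is S_{2m+1,n}(q).  The exponent ((2m+1)+1)/2 (n-k) is
   (m+1)(n-k); the half-integral powers of q that occur in S_{m,n} for even m
   are not needed. *)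
Definition qS_odd (m n : nat) : Fq :=
  \sum_(1 <= k < n.+1)
    qint (2 * k) / qint 2 * qint k ^+ (2 * m) * qF ^+ (m.+1 * (n - k)).

(* The property that characterizes the polynomials of Guo and Zeng.  It puts
   no condition on P m k for m < k. *)
Definition qFaulhaber (P : nat -> nat -> Zq) : Prop :=
  forall m n : nat, (1 <= n)%N ->
    qS_odd m n =
    \sum_(0 <= k < m.+1)
      (-1) ^+ (m - k) * (qfact k / qfact m.+1) * tofrac (P m (m - k)%N)
      * qF ^+ ((m - k) * n) * ((qint n * qint n.+1) ^+ k.+1 / qint 2).

Section CompleteHomogeneous.
Variable R : comNzRingType.

(* Sum of all monomials of degree d in the variables s_0, ..., s_(size s - 1):
   e is the vector of exponents. *)
Definition hsym (d : nat) (s : seq R) : R :=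
  \sum_(e : {ffun 'I_(size s) -> 'I_d.+1} | (\sum_(i < size s) e i == d)%N)
    \prod_(i < size s) s`_i ^+ e i.

End CompleteHomogeneous.

(* h_d({1,q}^r) for integers d and r, with value 0 if d < 0 or r < 0.  For
   r = 0 there are no variables, so the value is 0 for d > 0. *)
Definition h1q (d r : int) : Zq :=
  match d, r with
  | Posz d', Posz r' => hsym d' (nseq r' 'X ++ nseq r' 1)
  | _, _ => 0
  end.

(* A lattice path is given by its starting point and its word of steps; the
   step true is north, false is east. *)
Definition point : Type := (int * int)%type.

Definition lstep (p : point) (s : bool) : point :=
  if s then (p.1, p.2 + 1) else (p.1 + 1, p.2).

Definition lpath_end (p : point) (w : seq bool) : point := foldl lstep p w.

Definition lpath_points (p : point) (w : seq bool) : seq point :=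
  p :: scanl lstep p w.

Definition step_weight (p : point) (s : bool) : Zq :=
  if s && (2 %| p.1)%Z then 'X else 1.

Fixpoint lpath_weight (p : point) (w : seq bool) : Zq :=
  if w is s :: w' then step_weight p s * lpath_weight (lstep p s) w' else 1.

Definition lpath_length (a b : point) : nat :=
  absz (b.1 - a.1 + (b.2 - a.2))%R.

(* Every path from a to b has lpath_length a b steps, so the bound on the
   length of words in nonint_sum excludes no family. *)
Lemma lpath_size (a b : point) (w : seq bool) :
  lpath_end a w = b -> size w = lpath_length a b.
Proof.
move=> <-; rewrite /lpath_length /lpath_end.
suff -> : ((foldl lstep a w).1 - a.1) + ((foldl lstep a w).2 - a.2)
          = (size w)%:Z by [].
elim: w a => [|s w IH] a /=; first by lia.
rewrite -addn1 PoszD -(IH (lstep a s)); set e := foldl _ _ _.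
by case: s @e {IH} => e /=; lia.
Qed.

Section NonIntersecting.
Variables (k : nat) (a b : 'I_k -> point).

Definition nonint_bound : nat := \max_(j < k) lpath_length (a j) (b j).

(* The j-th path goes from a j to b j, and no two paths share a lattice
   point. *)
Definition nonint (f : 'I_k -> seq bool) : bool :=
  [forall j, lpath_end (a j) (f j) == b j] &&
  [forall i, forall j, (i != j) ==>
     ~~ has (mem (lpath_points (a i) (f i))) (lpath_points (a j) (f j))].

Definition nonint_sum : Zq :=
  \sum_(f : {ffun 'I_k -> nonint_bound.-bseq bool} | nonint (fun j => f j))
    \prod_(j < k) lpath_weight (a j) (f j).

End NonIntersecting.

(* Main.v *)
Require Import Defs.
From HB Require Import structures.
From mathcomp Require Import all_boot all_order all_algebra.
From mathcomp Require Import fraction zify ring.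

Set Implicit Arguments.
Unset Strict Implicit.
Unset Printing Implicit Defensive.

Import Order.TTheory GRing.Theory Num.Theory.
Local Open Scope ring_scope.

(* Put X_n = [n][n+1] / q^n and Y_n = [n]^2 / q^n.  Then X_n + X_(n-1) =
   (1+q) Y_n, X_n X_(n-1) = q Y_n^2 - Y_n and X_n - X_(n-1) = [2n] / q^n, so
   (X_n^(k+1) - X_(n-1)^(k+1)) / (X_n - X_(n-1)) is a polynomial phi_k in Y_n,
   whose generating function is 1 / ((1-Yt)(1-qYt) - Y t^2); hence the
   coefficient of Y^l in phi_k is h_(2l-k)({1,q}^(k-l+1)).  Dividing the
   q-Faulhaber identity by q^((m+1)n) and taking differences in n expresses Y^m
   in the basis (phi_k), at infinitely many points and so identically.  The
   matrix of the phi_k is lower triangular with diagonal entries [k+1], and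
   Cramer's rule gives the determinant.

   The determinant counts paths because both sides satisfy the same recurrence.
   All starting points lie on x + y = 0; remove the last step of a path whose
   endpoint has maximal x + y.  The determinant is linear in the corresponding
   row and vanishes when two endpoints coincide; the removed endpoint cannot lie
   on any other path, and the north-west to south-east order of the endpoints
   is preserved. *)

(** * Complete homogeneous symmetric polynomials *)

Section GeometricConvolution.
Variable R : comNzRingType.
Implicit Types (x y : R) (g : nat -> R) (s : seq R).

(* Multiplication of the power series with coefficients g by 1/(1 - x t). *)
Definition geomconv x g (d : nat) : R := \sum_(i < d.+1) x ^+ i * g (d - i)%N.

Lemma geomconv0 x g : geomconv x g 0 = g 0%N.
Proof. by rewrite /geomconv big_ord1 expr0 mul1r. Qed.

Lemma geomconvS x g d : geomconv x g d.+1 = g d.+1 + x * geomconv x g d.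
Proof.
rewrite /geomconv big_ord_recl expr0 mul1r subn0 mulr_sumr; congr (_ + _).
by apply: eq_bigr => i _; rewrite lift0 subSS exprS mulrA.
Qed.

Lemma eq_geomconv x g1 g2 : g1 =1 g2 -> geomconv x g1 =1 geomconv x g2.
Proof. by move=> eg d; apply: eq_bigr => i _; rewrite eg. Qed.

Lemma geomconv2S x y g d :
  geomconv x (geomconv y g) d.+2 =
  g d.+2 + (x + y) * geomconv x (geomconv y g) d.+1
  - x * y * geomconv x (geomconv y g) d.
Proof. by rewrite !geomconvS; ring. Qed.

(** The second-order recurrence [geomconv2S], which encodes division by (1 - xt)(1 - yt), is
    symmetric in x and y. The induction therefore carries two consecutive coefficients. *)
Lemma geomconvC x y g : geomconv x (geomconv y g) =1 geomconv y (geomconv x g).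
Proof.
move=> d; suff [] : geomconv x (geomconv y g) d = geomconv y (geomconv x g) d /\
  geomconv x (geomconv y g) d.+1 = geomconv y (geomconv x g) d.+1 by [].
elim: d => [|d [IH1 IH2]]; first by rewrite !(geomconv0, geomconvS); split; ring.
by split=> //; rewrite !geomconv2S IH1 IH2; ring.
Qed.

(** The coefficient sequence of the product of the series 1/(1 - xt) over the entries x of s. *)
Definition hser s : nat -> R := foldr geomconv (fun d => (d == 0%N)%:R) s.

Lemma hser_catC s x t : hser (s ++ x :: t) =1 geomconv x (hser (s ++ t)).
Proof.
elim: s => [|y s IH] //= d.
by rewrite (eq_geomconv _ IH) geomconvC.
Qed.

(** Truncating each geometric series at degree B leaves the coefficients up to B unchanged, so
    polynomials can replace power series. *)
Lemma coef_prod_geom B s d : (d <= B)%N ->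
  (\prod_(x <- s) \sum_(j < B.+1) (x ^+ j) *: 'X^j)`_d = hser s d.
Proof.
elim: s d => [|x s IH] d leB; first by rewrite big_nil coef1.
rewrite big_cons coefM /=; apply: eq_bigr => i _; rewrite IH; last by lia.
congr (_ * _); have iB : (i < B.+1)%N by have := ltn_ord i; lia.
rewrite coef_sum (bigD1 (Ordinal iB)) //= coefZ coefXn eqxx mulr1.
rewrite big1 ?addr0 // => j nj; rewrite coefZ coefXn.
case: eqP => [e|]; last by rewrite mulr0.
by case/eqP: nj; apply: val_inj.
Qed.

(** Distributing the product of truncated series over its sums, each choice e of exponents
    contributes its monomial in degree equal to the sum of e. *)
Lemma hsymE d s : hsym d s = hser s d.
Proof.
rewrite -(@coef_prod_geom d) // (big_nth 0) big_mkord bigA_distr_bigA coef_sum.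
rewrite /hsym [LHS]big_mkcond /=; apply: eq_bigr => e _.
rewrite (eq_bigr (fun i : 'I_(size s) => ((s`_i ^+ e i)%:P * 'X^(e i)))); last first.
  by move=> i _; rewrite mul_polyC.
rewrite big_split /= -rmorph_prod coefCM prodrXr coefXn eq_sym.
by case: eqP => _; rewrite ?mulr1 ?mulr0.
Qed.

End GeometricConvolution.

Lemma hsym_nseqS r d :
  hsym d (nseq r.+1 ('X : Zq) ++ nseq r.+1 1) =
  geomconv 'X (geomconv 1 (fun e => hsym e (nseq r ('X : Zq) ++ nseq r 1))) d.
Proof.
rewrite hsymE /=; apply: eq_geomconv => e; rewrite hser_catC.
by apply: eq_geomconv => f; rewrite hsymE.
Qed.

Lemma h1q_lt0 (d r : int) : d < 0 -> h1q d r = 0.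
Proof. by case: d. Qed.

Lemma h1q_le0 (d r : int) : r <= 0 -> 0 < d -> h1q d r = 0.
Proof.
case: d r => [[|d]|d] [[|r]|r] //= _ _.
by rewrite hsymE.
Qed.

Lemma h1q0 (r : int) : 0 <= r -> h1q 0 r = 1.
Proof.
case: r => [r|] //= _; elim: r => [|r IH]; first by rewrite hsymE.
by rewrite hsym_nseqS !geomconv0.
Qed.

(** Passing from r to r + 1 divides the generating series by (1 - qt)(1 - t) = 1 - (1 + q)t +
    qt^2. *)
Lemma h1q_rec (d r : int) : 0 <= r ->
  h1q d (r + 1) = (1 + 'X) * h1q (d - 1) (r + 1) + h1q d r - 'X * h1q (d - 2) (r + 1).
Proof.
case: r => [r|] //= _; rewrite [(r%:Z + 1)%R](_ : _ = Posz r.+1); last by lia.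
case: d => [[|[|d]]|d].
- by rewrite !h1q0 // !h1q_lt0 //; ring.
- rewrite [1%:Z - 1](_ : _ = 0%:Z) // (@h1q_lt0 (1%:Z - 2)) //.
  by rewrite /= !hsym_nseqS !(geomconv0, geomconvS); ring.
- rewrite [_ - 1](_ : _ = Posz d.+1); last by lia.
  rewrite [_ - 2](_ : _ = Posz d); last by lia.
  by rewrite /h1q [LHS]hsym_nseqS geomconv2S -!hsym_nseqS; ring.
- by rewrite !h1q_lt0 //; ring.
Qed.

Lemma h1q1 (d : nat) : h1q d 1 = \sum_(i < d.+1) 'X ^+ i.
Proof.
rewrite /= hsymE; apply: eq_bigr => i _.
have /= -> : hser [:: 1 : Zq] =1 fun=> 1; last by rewrite mulr1.
by elim=> [|e IH]; rewrite /= ?geomconv0 ?geomconvS //= add0r mul1r.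
Qed.

(** * Non-intersecting lattice paths *)

Definition ptime (p : point) : int := p.1 + p.2.

Definition lprev (p : point) (s : bool) : point :=
  if s then (p.1, p.2 - 1) else (p.1 - 1, p.2).

Lemma ptime_lstep p s : ptime (lstep p s) = ptime p + 1.
Proof. by rewrite /ptime; case: s => /=; ring. Qed.

Lemma ptime_lprev p s : ptime (lprev p s) = ptime p - 1.
Proof. by rewrite /ptime; case: s => /=; ring. Qed.

Lemma lstep_eq p s b : (lstep p s == b) = (p == lprev b s).
Proof. by case: p b s => [x y] [x' y'] [] /=; rewrite !xpair_eqE /=; lia. Qed.

Lemma ptime_lpath_end a w : ptime (lpath_end a w) = ptime a + (size w)%:Z.
Proof.
elim: w a => [|s w IH] a; first by rewrite /= addr0.
by rewrite /lpath_end /= -/(lpath_end _ _) IH ptime_lstep; lia.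
Qed.

Lemma lpath_end_rcons a w s : lpath_end a (rcons w s) = lstep (lpath_end a w) s.
Proof. by rewrite /lpath_end foldl_rcons. Qed.

Lemma lpath_points_rcons a w s :
  lpath_points a (rcons w s) = rcons (lpath_points a w) (lpath_end a (rcons w s)).
Proof. by rewrite /lpath_points scanl_rcons. Qed.

Lemma lpath_weight_rcons a w s :
  lpath_weight a (rcons w s) = lpath_weight a w * step_weight (lpath_end a w) s.
Proof.
elim: w a => [|t w IH] a /=; first by rewrite mulr1 mul1r.
by rewrite IH mulrA.
Qed.

Lemma mem_lpath_end a w : lpath_end a w \in lpath_points a w.
Proof.
case/lastP: w => [|w s]; first by rewrite inE.
by rewrite lpath_points_rcons mem_rcons mem_head.
Qed.

Lemma mem_lpath_points a w p : p \in lpath_points a w ->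
  p = lpath_end a w \/ ptime p < ptime (lpath_end a w).
Proof.
elim/last_ind: w => [|w s IH]; first by rewrite inE => /eqP; left.
rewrite lpath_points_rcons mem_rcons inE => /orP[/eqP|/IH H]; first by left.
right; rewrite lpath_end_rcons ptime_lstep.
by case: H => [->|]; lia.
Qed.

Lemma leq_homo_ltn k (s : 'I_k -> 'I_k) :
  {homo s : i j / (i < j)%N} -> forall i : 'I_k, (i <= s i)%N.
Proof.
move=> hs [i]; elim: i => // i IH ltik.
exact: leq_ltn_trans (IH (ltnW ltik)) (hs _ _ _).
Qed.

(** [leq_homo_ltn] bounds s from below by the identity; applied to the conjugate of s by [rev_ord],
    it bounds s from above. *)
Lemma homo_ltn_id k (s : 'I_k -> 'I_k) : {homo s : i j / (i < j)%N} -> s =1 id.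
Proof.
move=> hs i; apply: val_inj; apply/eqP; rewrite eqn_leq [X in _ && X](leq_homo_ltn hs) andbT.
have hr : {homo (fun j => rev_ord (s (rev_ord j))) : i j / (i < j)%N}.
  move=> j l ltjl; have /hs : (rev_ord l < rev_ord j)%N.
    by rewrite /=; have := ltn_ord l; lia.
  by rewrite /=; have := ltn_ord (s (rev_ord j)); have := ltn_ord (s (rev_ord l)); lia.
have := leq_homo_ltn hr (rev_ord i); rewrite rev_ordK /=.
by have := ltn_ord i; have := ltn_ord (s i); lia.
Qed.

(** * Determinants and families of paths under removal of a last step *)

Section LatticePathDeterminant.
Variables (k : nat) (a : 'I_k -> point).
Hypothesis a0 : forall j, ptime (a j) = 0.
Hypothesis a_lt : forall i j : 'I_k, (i < j)%N -> (a i).1 < (a j).1.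

(** The length bound is a parameter, so that the index type of the sum stays fixed while the
    endpoints change. *)
Definition nonint_sum_bound B (b : 'I_k -> point) : Zq :=
  \sum_(f : {ffun 'I_k -> B.-bseq bool} | nonint a b (fun j => f j))
    \prod_(j < k) lpath_weight (a j) (f j).

Definition upd_end (b : 'I_k -> point) i p := fun j => if j == i then p else b j.

Lemma nonintP b (f : 'I_k -> seq bool) :
  reflect ((forall j, lpath_end (a j) (f j) = b j) /\
           forall i j p, i != j -> p \in lpath_points (a i) (f i) ->
              p \notin lpath_points (a j) (f j))
          (nonint a b f).
Proof.
apply: (iffP andP) => -[H1 H2]; split.
- by move=> j; apply/eqP/(forallP H1).
- move=> i j p nij pi; apply/negP => pj.
  have /forallP/(_ j)/implyP/(_ nij)/hasP := forallP H2 i.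
  by case; exists p.
- by apply/forallP => j; rewrite H1.
- apply/forallP => i; apply/forallP => j; apply/implyP => nij.
  by apply/hasPn => p pj; apply/negP => /= pi; have := H2 i j p nij pi; rewrite pj.
Qed.

Lemma nonint_sum_bound_eq0 B b :
  (forall f, nonint a b f -> False) -> nonint_sum_bound B b = 0.
Proof. by move=> H; rewrite /nonint_sum_bound big1 // => f /H. Qed.

(** The only point added is [b i]. Every point of another path is either its endpoint, different
    from [b i], or has [ptime] strictly below the maximum. *)
Lemma nonint_extend b i s (g : 'I_k -> seq bool) :
  (forall j, ptime (b j) <= ptime (b i)) -> (forall j, j != i -> b j != b i) ->
  nonint a b (fun j => if j == i then rcons (g i) s else g j) =
  nonint a (upd_end b i (lprev (b i) s)) g.
Proof.
move=> bmax bneq; apply/nonintP/nonintP => -[H1 H2]; split.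
- move=> j; have := H1 j; rewrite /upd_end; case: eqP => // -> /eqP.
  by rewrite lpath_end_rcons lstep_eq => /eqP.
- move=> j l p njl pj; have := H2 j l p njl.
  have -> : p \in lpath_points (a j) (if j == i then rcons (g i) s else g j).
    by case: eqP pj => // ->; rewrite lpath_points_rcons mem_rcons inE orbC => ->.
  move=> /(_ isT); case: eqP => // ->.
  by rewrite lpath_points_rcons mem_rcons inE negb_or => /andP[].
- move=> j; have := H1 j; rewrite /upd_end; case: eqP => // -> /eqP.
  by rewrite lpath_end_rcons => H; apply/eqP; rewrite lstep_eq.
- have endi : lpath_end (a i) (rcons (g i) s) = b i.
    apply/eqP; rewrite lpath_end_rcons lstep_eq; apply/eqP.
    by rewrite H1 /upd_end eqxx.
  have noti l : l != i -> b i \notin lpath_points (a l) (g l).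
    move=> nli; apply/negP => /mem_lpath_points.
    rewrite H1 /upd_end (negbTE nli) => -[E|]; last by rewrite ltNge bmax.
    by have := bneq l nli; rewrite E eqxx.
  move=> j l p njl; case: (eqVneq j i) => [ji|nji].
    rewrite ji lpath_points_rcons mem_rcons inE endi.
    have nli : l != i by rewrite -ji eq_sym.
    rewrite (negbTE nli) => /orP[/eqP ->|pi]; first exact: noti.
    by apply: (H2 i); rewrite // eq_sym.
  move=> pj; case: (eqVneq l i) => [li|nli]; last exact: (H2 j).
  rewrite li lpath_points_rcons mem_rcons inE endi negb_or (H2 j) // -?li // li.
  by rewrite andbT; apply: contraTneq pj => ->; exact: noti.
Qed.

(** Families are sorted by the last step of path i; appending and deleting that step are inverse
    bijections. *)
Lemma nonint_sum_bound_rec B b i :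
  ptime (b i) <= B%:Z -> 0 < ptime (b i) ->
  (forall j, ptime (b j) <= ptime (b i)) -> (forall j, j != i -> b j != b i) ->
  nonint_sum_bound B b =
  \sum_s step_weight (lprev (b i) s) s *
         nonint_sum_bound B (upd_end b i (lprev (b i) s)).
Proof.
move=> leB gt0 bmax bneq; rewrite /nonint_sum_bound.
(* The default [true] is never read: path i rises from [ptime] 0 to a positive value, so its word is
   nonempty. *)
rewrite (partition_big (fun f : {ffun 'I_k -> B.-bseq bool} => last true (f i))
           xpredT) //=.
apply: eq_bigr => s _.
pose ext (g : {ffun 'I_k -> B.-bseq bool}) : {ffun 'I_k -> B.-bseq bool} :=
  [ffun j => if j == i then insub_bseq B (rcons (g i) s) else g j].
pose cut (g : {ffun 'I_k -> B.-bseq bool}) : {ffun 'I_k -> B.-bseq bool} :=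
  [ffun j => if j == i then insub_bseq B (take (size (g i)).-1 (g i)) else g j].
have insubK (w : seq bool) : (size w <= B)%N -> insub_bseq B w = w :> seq bool.
  by move=> H; rewrite /insub_bseq insubdK.
have szlt b' (f : 'I_k -> seq bool) j : nonint a b' f -> (size (f j))%:Z = ptime (b' j).
  by case/nonintP => H _; rewrite -H ptime_lpath_end a0 add0r.
rewrite (reindex_onto ext cut) /=; last first.
  move=> f /andP[nf /eqP ls]; apply/ffunP => j; rewrite !ffunE eqxx.
  case: eqP => // ->; apply: val_inj.
  have sB := size_bseq (f i); have /= fi := szlt _ _ i nf.
  have cutB : (size (take (size (f i)).-1 (f i)) < B)%N.
    by rewrite size_take; case: ifP; lia.
  rewrite /= (insubK (take _ _)) ?(ltnW cutB) // insubK ?size_rcons //.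
  rewrite -ls; case/lastP: (f i : seq bool) fi => [|w t] /=; first by lia.
  by rewrite last_rcons size_rcons /= -[in take _ _]cats1 take_size_cat.
rewrite mulr_sumr (eq_bigl (fun g : {ffun 'I_k -> B.-bseq bool} =>
  nonint a (upd_end b i (lprev (b i) s)) (fun j => g j))); last first.
  move=> g; case sz: (size (g i) < B)%N.
    have -> : nonint a b (fun j => ext g j) =
       nonint a b (fun j => if j == i then rcons (g i) s else g j).
      rewrite /nonint; congr andb.
        by apply: eq_forallb => j; rewrite ffunE; case: (j == i);
          rewrite ?insubK ?size_rcons.
      apply: eq_forallb => j; apply: eq_forallb => l; rewrite !ffunE.
      by case: (j == i); case: (l == i); rewrite ?insubK ?size_rcons.
    rewrite nonint_extend // ffunE eqxx insubK ?size_rcons // last_rcons eqxx andbT.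
    rewrite [cut _ == g](_ : _ = true) ?andbT //; apply/eqP/ffunP => j.
    rewrite !ffunE eqxx; case: eqP => // ->; apply: val_inj.
    rewrite /= insubK ?insubK ?size_rcons //= -cats1 take_size_cat //.
    by have := size_bseq (g i); lia.
  (* Here [g i] already has length B. Both sides are false: [cut] only yields words shorter than B,
     and a path to [lprev (b i) s] has length at most B - 1. *)
  apply/idP/idP => [/andP[_ /eqP E]|nf]; last first.
    have /= := szlt _ _ i nf; rewrite /upd_end eqxx ptime_lprev; lia.
  have := congr1 (fun f : {ffun 'I_k -> B.-bseq bool} => size (f i)) E.
  rewrite !ffunE eqxx.
  have sB := size_bseq (insub_bseq B (rcons (g i) s)).
  by rewrite insubK size_take; move: sB sz; set z := size (insub_bseq _ _); case: ifP; lia.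
apply: eq_bigr => g ng.
have sz : (size (g i) < B)%N.
  by have /= := szlt _ _ i ng; rewrite /upd_end eqxx ptime_lprev; lia.
rewrite (bigD1 i) //= [in RHS](bigD1 i) //= ffunE eqxx insubK ?size_rcons //.
rewrite lpath_weight_rcons; case/nonintP: ng => /(_ i) -> _.
rewrite /upd_end eqxx [_ * step_weight _ _]mulrC -!mulrA; congr (_ * (_ * _)).
by apply: eq_bigr => j /negbTE nj; rewrite ffunE nj.
Qed.

(** [g j p] stands for the weighted count of paths from [a j] to p, specified by its values up to
    the starting line and by its last-step recurrence. *)
Variable g : 'I_k -> point -> Zq.
Hypothesis g_lt0 : forall j p, ptime p < 0 -> g j p = 0.
Hypothesis g_eq0 : forall j p, ptime p = 0 -> g j p = (p == a j)%:R.
Hypothesis g_gt0 : forall j p, 0 < ptime p ->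
  g j p = \sum_s step_weight (lprev p s) s * g j (lprev p s).

(** All paths are empty here. If the ends are the starts, the matrix is the identity and there is
    one family. Otherwise there is no family, and some end is not a start, which gives a zero row:
    if every [b i] were some [a (s i)], then s would be increasing, hence the identity. *)
Lemma det_nonint_start B b :
  (forall i, ptime (b i) = 0) ->
  (forall i j : 'I_k, (i < j)%N -> (b i).1 < (b j).1) ->
  \det (\matrix_(i < k, j < k) g j (b i)) = nonint_sum_bound B b.
Proof.
move=> b0 blt.
have a_inj i j : (a i == a j) = (i == j).
  apply/eqP/eqP => [e|->//]; apply: val_inj.
  by case: (ltngtP i j) => // /a_lt; rewrite e ltxx.
case: (boolP [forall i, b i == a i]) => [/forallP ba|/forallP nba].
  have -> : \matrix_(i < k, j < k) g j (b i) = 1%:M.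
    by apply/matrixP => i j; rewrite !mxE g_eq0 // (eqP (ba i)) a_inj.
  rewrite det1 /nonint_sum_bound (big_pred1 [ffun=> insub_bseq B [::]]); last first.
    move=> f; apply/nonintP/eqP => [[H _]|->].
      apply/ffunP => j; rewrite ffunE; apply: val_inj; rewrite /= /insub_bseq insubdK //.
      apply: size0nil; have := congr1 ptime (H j).
      by rewrite ptime_lpath_end a0 b0; lia.
    split=> [j|i j p nij]; rewrite !ffunE /insub_bseq !insubdK //; first by rewrite (eqP (ba j)).
    by rewrite !inE => /eqP ->; rewrite a_inj.
  by rewrite big1 // => j _; rewrite ffunE /insub_bseq insubdK.
rewrite nonint_sum_bound_eq0; last first.
  move=> f /nonintP[H _]; case: nba => i; rewrite -H; have := congr1 ptime (H i).
  by rewrite ptime_lpath_end a0 b0; case: (f i).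
case: (boolP [forall i, exists j, b i == a j]) => [/forallP bs|].
  case: nba; have /fin_all_exists[s bsE] : forall i, exists j, b i = a j.
    by move=> i; have /existsP[j /eqP] := bs i; exists j.
  have sid : s =1 id.
    apply: homo_ltn_id => i j /blt; rewrite !bsE => lta.
    case: (ltngtP (s i) (s j)) => //; first by move/a_lt; lia.
    by move/val_inj => e; move: lta; rewrite e ltxx.
  by move=> i; rewrite bsE sid.
rewrite negb_forall => /existsP[i /existsPn bi].
rewrite (expand_det_row _ i) big1 // => j _.
by rewrite mxE g_eq0 // (negbTE (bi j)) mul0r.
Qed.

(** The induction is on the total distance of the ends from the starting line. The order on the ends
    is weak because removing a step may make two of them coincide. *)
Lemma det_nonint B b :
  (forall i, ptime (b i) <= B%:Z) ->
  (forall i j : 'I_k, (i < j)%N -> (b i).1 <= (b j).1 /\ (b j).2 <= (b i).2) ->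
  \det (\matrix_(i < k, j < k) g j (b i)) = nonint_sum_bound B b.
Proof.
have [n] := ubnP (\sum_i absz (ptime (b i)))%N.
elim: n b => // n IH b ltn leB bord.
case: (boolP [exists i, ptime (b i) < 0]) => [/existsP[i bi]|].
  rewrite nonint_sum_bound_eq0; last first.
    by move=> f /nonintP[H _]; move: bi; rewrite -H ptime_lpath_end a0; lia.
  by rewrite (expand_det_row _ i) big1 // => j _; rewrite mxE g_lt0 ?mul0r.
rewrite negb_exists => /forallP b_ge0.
case: (boolP [exists i, exists j, (i != j) && (b i == b j)]).
  move=> /existsP[i /existsP[j /andP[nij /eqP bij]]].
  rewrite nonint_sum_bound_eq0; last first.
    move=> f /nonintP[H1 H2].
    have bi : b i \in lpath_points (a i) (f i) by rewrite -H1 mem_lpath_end.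
    by have /negP[] := H2 _ _ _ nij bi; rewrite bij -H1 mem_lpath_end.
  by apply: (determinant_alternate nij) => l; rewrite !mxE bij.
rewrite negb_exists => /forallP b_inj0.
have b_inj i j : i != j -> b i != b j.
  by move=> nij; have /existsPn/(_ j) := b_inj0 i; rewrite nij.
case: (boolP [exists i, 0 < ptime (b i)]) => [/existsP[i0 bi0]|]; last first.
  rewrite negb_exists => /forallP b_le0.
  have b0 i : ptime (b i) = 0 by have := b_ge0 i; have := b_le0 i; lia.
  (* On the line x + y = 0, ends with equal first coordinates coincide, so distinctness makes the
     order strict. *)
  apply: det_nonint_start => // i j ltij; have [le1 _] := bord i j ltij.
  rewrite lt_neqAle le1 andbT; apply/negP => /eqP e.
  have /eqP[] : b i != b j by apply: b_inj; rewrite neq_ltn ltij.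
  have := b0 i; have := b0 j; rewrite /ptime.
  by case: (b i) (b j) e => [x y] [x' y'] /= -> ? ?; congr pair; lia.
have [i _ imax] := @arg_maxnP _ i0 xpredT (fun i => absz (ptime (b i))) isT.
have bmax j : ptime (b j) <= ptime (b i).
  by have := imax j isT; have := b_ge0 i; have := b_ge0 j; rewrite /=; lia.
have bi_gt0 : 0 < ptime (b i) by apply: lt_le_trans bi0 (bmax i0).
rewrite (nonint_sum_bound_rec (leB i) bi_gt0 bmax) => [|j nji]; last exact: b_inj.
have IHs s : \det (\matrix_(i', j) g j (upd_end b i (lprev (b i) s) i')) =
    nonint_sum_bound B (upd_end b i (lprev (b i) s)).
  apply: IH.
  - move: ltn; rewrite (bigD1 i) //= [X in _ -> (X < _)%N](bigD1 i) //= /upd_end eqxx.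
    rewrite [X in _ -> (_ + X < _)%N](eq_bigr (fun j => absz (ptime (b j)))); last first.
      by move=> j /negbTE ->.
    by rewrite ptime_lprev; lia.
  - move=> j; rewrite /upd_end; case: eqP => // _; rewrite ptime_lprev.
    by have := leB i; lia.
  (* Removing a step could break a weak inequality only if it was an equality; the maximality of
     [ptime (b i)] would then force [b j = b l]. *)
  - move=> j l ltjl; have [le1 le2] := bord j l ltjl; rewrite /upd_end.
    have /b_inj : j != l by rewrite neq_ltn ltjl.
    have := bmax j; have := bmax l; rewrite /ptime.
    case: (eqVneq j i) => [ji|nji]; case: (eqVneq l i) => [li|nli] //=.
    + rewrite -ji; case: (b j) (b l) le1 le2 => [x y] [x' y'] /=.
      by rewrite xpair_eqE; case: s => /=; lia.
    + rewrite -li; case: (b j) (b l) le1 le2 => [x y] [x' y'] /=.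
      by rewrite xpair_eqE; case: s => /=; lia.
rewrite big_bool -!IHs; apply: (@determinant_multilinear _ _ _ _ _ i).
- apply/rowP => j; rewrite !mxE /upd_end eqxx.
  by rewrite [in LHS]g_gt0 // big_bool.
- by apply/matrixP => j l; rewrite !mxE /upd_end eq_sym (negbTE (neq_lift _ _)).
- by apply/matrixP => j l; rewrite !mxE /upd_end eq_sym (negbTE (neq_lift _ _)).
Qed.

End LatticePathDeterminant.

(* Weights of the vertical steps in the columns n - 1, ..., 0. *)
Fixpoint column_weights (n : nat) : seq Zq :=
  if n is n'.+1 then (if odd n' then 1 else 'X) :: column_weights n' else [::].

Lemma hser_column_weights r d :
  hser (column_weights (2 * r)) d = hsym d (nseq r ('X : Zq) ++ nseq r 1).
Proof.
elim: r d => [|r IH] d; first by rewrite hsymE.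
rewrite hsym_nseqS geomconvC.
have -> : (2 * r.+1)%N = (2 * r).+2 by lia.
rewrite /= mul2n odd_double /= -mul2n.
by apply: eq_geomconv => e; apply: eq_geomconv => f; rewrite IH.
Qed.

(** A path is determined by the number of its vertical steps in each of the dx + 1 columns, which
    gives a complete homogeneous polynomial in the column weights. Columns are numbered from [a.1],
    so the weights are the intended ones when [a.1] is even. *)
Definition path_gf (a p : point) : Zq :=
  match p.1 - a.1, p.2 - a.2 with
  | Posz dx, Posz dy => hser (column_weights dx.+1) dy
  | _, _ => 0
  end.

Lemma path_gf_lt0 a p : ptime a = 0 -> ptime p < 0 -> path_gf a p = 0.
Proof.
rewrite /ptime /path_gf => a0 p0.
case E1: (p.1 - a.1) => [dx|] //; case E2: (p.2 - a.2) => [dy|] //.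
by lia.
Qed.

Lemma path_gf_eq0 a p : ptime a = 0 -> ptime p = 0 -> path_gf a p = (p == a)%:R.
Proof.
rewrite /ptime /path_gf; case: a p => [x y] [x' y'] /= a0 p0; rewrite xpair_eqE.
case E1: (x' - x) => [dx|dx]; last by rewrite [_ == x](_ : _ = false) //; lia.
case E2: (y' - y) => [dy|dy]; last by rewrite [_ == y](_ : _ = false) ?andbF //; lia.
have -> : dx = 0%N by lia.
have -> : dy = 0%N by lia.
have -> : (x' == x) = true by lia.
have -> : (y' == y) = true by lia.
by rewrite /= geomconv0.
Qed.

(** This is [geomconvS] for the last column: the final step either enters that column from the west
    or climbs within it. *)
Lemma path_gf_gt0 a p : ptime a = 0 -> (2 %| a.1)%Z -> 0 < ptime p ->
  path_gf a p = \sum_s step_weight (lprev p s) s * path_gf a (lprev p s).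
Proof.
rewrite /ptime /path_gf big_bool /step_weight /=.
case: a p => [x y] [x' y'] /= a0 even p0.
have -> : x' - 1 - x = x' - x - 1 by ring.
have -> : y' - 1 - y = y' - y - 1 by ring.
case E1: (x' - x) => [dx|dx]; last by rewrite !(mulr0, add0r).
have -> : (2 %| x')%Z = ~~ odd dx by lia.
case E2: (y' - y) => [[|dy]|dy]; last 1 first.
- by case: (dx%:Z - 1) => *; rewrite !(mulr0, addr0).
- case: dx E1 => [|dx] E1; first by lia.
  have -> : dx.+1%:Z - 1 = dx by lia.
  by rewrite mulr0 add0r mul1r /= !geomconv0.
have -> : dy.+1%:Z - 1 = dy by lia.
case: dx E1 => [|dx] E1; first by rewrite /= geomconvS /= mulr0 addr0 add0r.
have -> : dx.+1%:Z - 1 = dx by lia.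
rewrite -[LHS]/(geomconv (if odd dx.+1 then 1 else 'X)
                   (hser (column_weights dx.+1)) dy.+1) geomconvS mul1r addrC.
by case: (odd dx.+1).
Qed.

Lemma path_gf_h1q (i j : nat) (c : int) : -1 <= c ->
  path_gf (2 * j%:Z, - (2 * j%:Z)) (2 * i%:Z + 3, c - i%:Z) =
  h1q (c - i%:Z + 2 * j%:Z) (i%:Z - j%:Z + 2).
Proof.
move=> c_ge; rewrite /path_gf /= opprK.
case E1: (2 * i%:Z + 3 - 2 * j%:Z) => [dx|dx].
  case E2: (c - i%:Z + 2 * j%:Z) => [dy|dy]; last by rewrite h1q_lt0.
  have [r Er] : exists r : nat, (i%:Z - j%:Z + 2) = r by exists (absz (i%:Z - j%:Z + 2)); lia.
  rewrite -[LHS]/(hser (column_weights dx.+1) dy).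
  by rewrite Er (_ : dx.+1 = 2 * r)%N ?hser_column_weights //; lia.
(* The end lies west of the start, so j is at least i + 2, and c at least -1 makes the degree
   positive. This excludes degree 0 in no variables, where [h1q] is 1. *)
case: (ltP 0 (c - i%:Z + 2 * j%:Z)) => [d_gt0|d_le0]; first by rewrite h1q_le0 //; lia.
by rewrite h1q_lt0 //; lia.
Qed.

Lemma det_h1q_nonint (k : nat) (c : int) : -1 <= c ->
  \det (\matrix_(i < k, j < k) h1q (c - i%:Z + 2 * j%:Z) (i%:Z - j%:Z + 2)) =
  nonint_sum (fun j : 'I_k => (2 * j%:Z, - (2 * j%:Z)))
             (fun j : 'I_k => (2 * j%:Z + 3, c - j%:Z)).
Proof.
move=> c_ge; set a := fun j : 'I_k => (2 * j%:Z, - (2 * j%:Z)).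
set b := fun j : 'I_k => (2 * j%:Z + 3, c - j%:Z).
have a0 j : ptime (a j) = 0 by rewrite /ptime /=; lia.
rewrite -[RHS]/(nonint_sum_bound a (nonint_bound a b) b).
rewrite -(@det_nonint k a a0 _ (fun j => path_gf (a j))).
- by congr (\det _); apply/matrixP => i j; rewrite !mxE path_gf_h1q.
- by move=> i j ltij /=; lia.
- by move=> j p; apply: path_gf_lt0.
- by move=> j p; apply: path_gf_eq0.
- by move=> j p; apply: path_gf_gt0; rewrite //=; lia.
- move=> i; apply: (@le_trans _ _ (lpath_length (a i) (b i))%:Z).
    by rewrite /lpath_length /ptime /=; lia.
  by rewrite lez_nat /nonint_bound (leq_bigmax_cond (F := fun j => lpath_length (a j) (b j))).
- by move=> i j ltij /=; lia.
Qed.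

(** * The q-Faulhaber polynomials *)

(** Integer indices let the recurrence shift l below 0, where the value is 0. *)
Definition phi_coef (k l : int) : Zq := h1q (2 * l - k) (k - l + 1).

Lemma phi_coef_gt (k l : int) : 0 <= k -> k < l -> phi_coef k l = 0.
Proof. by move=> k0 kl; apply: h1q_le0; lia. Qed.

Lemma phi_coef_lt0 (k l : int) : 0 <= k -> l < 0 -> phi_coef k l = 0.
Proof. by move=> k0 l0; apply: h1q_lt0; lia. Qed.

Lemma phi_coef_rec (k l : int) : 0 <= k ->
  phi_coef (k + 2) l = (1 + 'X) * phi_coef (k + 1) (l - 1)
    + phi_coef k (l - 1) - 'X * phi_coef k (l - 2).
Proof.
(* [h1q_rec] requires k - l + 2 to be nonnegative; beyond that range all terms vanish. *)
move=> k0; case: (ltP (k + 2) l) => [ltkl|lelk].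
  by rewrite !phi_coef_gt //; [ring | lia..].
rewrite /phi_coef.
rewrite h1q_rec; last by lia.
by congr (_ * h1q _ _ + h1q _ _ - _ * h1q _ _); ring.
Qed.

(* (a^(k+1) - b^(k+1)) / (a - b) as a polynomial in y, when a + b = (1 + q) y
   and a b = q y^2 - y. *)
Fixpoint phi_pair (k : nat) : {poly Zq} * {poly Zq} :=
  if k is k'.+1 then
    let: (u, v) := phi_pair k' in
    (v, (1 + 'X)%:P * 'X * v + ('X - 'X%:P * 'X^2) * u)
  else (1, (1 + 'X)%:P * 'X).

Definition phi k := (phi_pair k).1.

Lemma phi0 : phi 0 = 1. Proof. by []. Qed.
Lemma phi1 : phi 1 = (1 + 'X)%:P * 'X. Proof. by []. Qed.
Lemma phiSS k :
  phi k.+2 = (1 + 'X)%:P * 'X * phi k.+1 + ('X - 'X%:P * 'X^2) * phi k.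
Proof. by rewrite /phi /=; case: (phi_pair k). Qed.

Lemma coef_phi k (l : nat) : (phi k)`_l = phi_coef k l.
Proof.
suff [] : (forall l : nat, (phi k)`_l = phi_coef k l) /\
  (forall l : nat, (phi k.+1)`_l = phi_coef k.+1 l) by [].
elim: k {l} => [|k [IH1 IH2]]; split=> // l.
- rewrite phi0 coef1; case: l => [|l]; last by rewrite phi_coef_gt.
  by rewrite /phi_coef h1q0.
- rewrite phi1 coefCM coefX; case: l => [|[|l]]; rewrite ?mulr0 ?mulr1.
  + by rewrite /phi_coef h1q_lt0.
  + by rewrite /phi_coef (h1q1 1) big_ord_recl big_ord1.
  + by rewrite phi_coef_gt.
have -> : (k.+2%:Z = k%:Z + 2) by lia.
rewrite phi_coef_rec // phiSS mulrBl -!mulrA coefD coefB !coefCM !coefXM.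
case: l => [|[|l]] /=.
- by rewrite !phi_coef_lt0 //; ring.
- by rewrite IH1 IH2 (@phi_coef_lt0 k (1%:Z - 2)) // -addn1 PoszD; ring.
- rewrite !IH1 IH2.
  have -> : l.+2%:Z - 2 = l by lia.
  have -> : l.+2%:Z - 1 = l.+1 by lia.
  have -> : k%:Z + 1 = k.+1 by lia.
  by ring.
Qed.

(** Both a and b are roots of z^2 - (1 + q)yz + (qy^2 - y), so their powers, and the differences of
    these, obey the recurrence [phiSS]. *)
Lemma horner_phi (a b y : Fq) k :
  a + b = (1 + qF) * y -> a * b = qF * y ^+ 2 - y ->
  (a - b) * (map_poly (@tofrac _) (phi k)).[y] = a ^+ k.+1 - b ^+ k.+1.
Proof.
move=> sab pab.
suff [] : (a - b) * (map_poly (@tofrac _) (phi k)).[y] = a ^+ k.+1 - b ^+ k.+1 /\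
  (a - b) * (map_poly (@tofrac _) (phi k.+1)).[y] = a ^+ k.+2 - b ^+ k.+2 by [].
have qE : tofrac (1 + 'X : Zq) = 1 + qF by rewrite rmorphD rmorph1.
elim: k => [|k [IH1 IH2]]; split=> //.
- by rewrite phi0 rmorph1 hornerE mulr1 !expr1.
- by rewrite phi1 rmorphM /= map_polyC map_polyX !hornerE /= qE -mulrA -sab; ring.
rewrite phiSS rmorphD !rmorphM rmorphB rmorphM /= !map_polyC !map_polyX map_polyXn.
rewrite !hornerE /= qE -/qF.
transitivity ((1 + qF) * y * ((a - b) * (map_poly (@tofrac _) (phi k.+1)).[y])
   - (qF * y ^+ 2 - y) * ((a - b) * (map_poly (@tofrac _) (phi k)).[y])); first by ring.
by rewrite IH1 IH2 -sab -pab !exprS; ring.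
Qed.

(** * Identities between q-integers *)

Lemma qF_neq0 : qF != 0.
Proof. by rewrite tofrac_eq0 polyX_eq0. Qed.

Lemma oneBqFX_neq0 n : 1 - qF ^+ n.+1 != 0.
Proof.
rewrite -tofracXn -tofrac1 -tofracB tofrac_eq0.
by apply/negP => /eqP/(congr1 (fun p : Zq => p.[0])); rewrite !hornerE expr0n.
Qed.

Lemma oneBqF_neq0 : 1 - qF != 0.
Proof. by have := oneBqFX_neq0 0; rewrite expr1. Qed.

Lemma qint_neq0 n : qint n.+1 != 0.
Proof. by rewrite mulf_neq0 ?invr_neq0 ?oneBqFX_neq0 ?oneBqF_neq0. Qed.

Lemma qintE n : qint n = tofrac (\sum_(i < n) 'X ^+ i : Zq).
Proof.
apply: (mulIf oneBqF_neq0); rewrite /qint divfK ?oneBqF_neq0 //.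
rewrite -[in RHS]tofrac1 -tofracB -tofracM -tofracXn -tofrac1 -tofracB; congr tofrac.
by rewrite -opprB subrX1 mulrC -mulrN opprB.
Qed.

Definition qY (n : nat) : Fq := qint n ^+ 2 / qF ^+ n.
Definition qX (n : nat) : Fq := qint n * qint n.+1 / qF ^+ n.

Section FieldIdentities.
Variables (F : fieldType) (q u : F).
Hypotheses (q1 : 1 - q != 0) (q0 : q != 0) (u0 : u != 0).

(** For v = q^n these are [qX n] and [qY n], and multiplying v by q raises n by one. With q^n
    treated as a free variable, the identities are rational and [field] proves them. *)
Let X (v : F) := (1 - v) / (1 - q) * ((1 - q * v) / (1 - q)) / v.
Let Y (v : F) := ((1 - v) / (1 - q)) ^+ 2 / v.

Lemma X_sum_identity : X (q * u) + X u = (1 + q) * Y (q * u).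
Proof. by rewrite /X /Y; field; rewrite ?q1 ?q0 ?u0. Qed.

Lemma X_prod_identity : X (q * u) * X u = q * Y (q * u) ^+ 2 - Y (q * u).
Proof. by rewrite /X /Y; field; rewrite ?q1 ?q0 ?u0. Qed.

Lemma X_diff_identity :
  X (q * u) - X u = (1 - q * u * (q * u)) / (1 - q) / (q * u).
Proof. by rewrite /X; field; rewrite ?q1 ?q0 ?u0. Qed.

Lemma Y_eq_cross (v : F) : v != 0 -> Y u = Y (u * v) ->
  (1 - u) ^+ 2 * v = (1 - u * v) ^+ 2.
Proof.
move=> v0 e; have -> : (1 - u) ^+ 2 * v = Y u * (u * v * (1 - q) ^+ 2).
  by rewrite /Y; field; rewrite ?q1 ?u0.
by rewrite e /Y; field; rewrite ?q1 ?v0 ?u0.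
Qed.

End FieldIdentities.

Lemma qX_sum n : qX n.+1 + qX n = (1 + qF) * qY n.+1.
Proof.
rewrite /qX /qY /qint !(exprS qF).
exact: (X_sum_identity oneBqF_neq0 qF_neq0 (expf_neq0 n qF_neq0)).
Qed.

Lemma qX_prod n : qX n.+1 * qX n = qF * qY n.+1 ^+ 2 - qY n.+1.
Proof.
rewrite /qX /qY /qint !(exprS qF).
exact: (X_prod_identity oneBqF_neq0 qF_neq0 (expf_neq0 n qF_neq0)).
Qed.

Lemma qX_diff n : qX n.+1 - qX n = qint (2 * n.+1) / qF ^+ n.+1.
Proof.
rewrite /qX /qint mul2n -addnn exprD !(exprS qF).
exact: (X_diff_identity oneBqF_neq0 qF_neq0 (expf_neq0 n qF_neq0)).
Qed.

(** For n < p, clearing denominators leaves an identity in Z[q] whose constant terms are 0 and 1. *)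
Lemma qY_inj : injective (fun n => qY n.+1).
Proof.
have H n p : (n < p)%N -> qY n.+1 != qY p.+1.
  move=> ltnp; apply/negP => /eqP e.
  have : (1 - qF ^+ n.+1) ^+ 2 * qF ^+ (p - n) = (1 - qF ^+ p.+1) ^+ 2.
    move: e; rewrite /qY /qint; have -> : (p.+1 = n.+1 + (p - n))%N by lia.
    rewrite !(exprD qF n.+1).
    exact: (Y_eq_cross oneBqF_neq0 (expf_neq0 _ qF_neq0) (expf_neq0 _ qF_neq0)).
  rewrite -!tofracXn -tofrac1 -!tofracB -!tofracXn -tofracM => /eqP.
  rewrite tofrac_eq => /eqP/(congr1 (fun p : Zq => p.[0])).
  by rewrite !hornerE /= !expr0n /= subn_eq0 leqNgt ltnp; lia.
move=> n p e; case: (ltngtP n p) => // /H; first by rewrite e eqxx.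
by rewrite /= e eqxx.
Qed.

Lemma poly_eq0_inj (F : idomainType) (p : {poly F}) (y : nat -> F) :
  injective y -> (forall n, p.[y n] = 0) -> p = 0.
Proof.
move=> y_inj py; apply/eqP; apply: contraT => p0.
have := @max_poly_roots _ p [seq y i | i <- iota 0 (size p)] p0.
rewrite size_map size_iota ltnn map_inj_uniq // iota_uniq; apply=> //.
by apply/allP => _ /mapP[i _ ->]; rewrite rootE py.
Qed.

Lemma qS_oddS m n :
  qS_odd m n.+1 = qF ^+ m.+1 * qS_odd m n +
    qint (2 * n.+1) / qint 2 * qint n.+1 ^+ (2 * m).
Proof.
rewrite /qS_odd big_nat_recr //= subnn muln0 expr0 mulr1; congr (_ + _).
rewrite mulr_sumr !big_nat; apply: eq_bigr => k /andP[_ lekn].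
by rewrite subSn // mulnS exprD; ring.
Qed.

(** Applied with u = q^(n+1), d = [2(n+1)], e = [2], y = [n+1], w = q^(m+1), s = S_(2m+1,n), and
    with m as the exponent called n here. *)
Lemma telescoping_identity (F : fieldType) (u d e y s w : F) n : u != 0 -> e != 0 ->
  u ^+ n.+1 * (d / u * (y ^+ 2 / u) ^+ n) =
  (w * s + d / e * y ^+ (2 * n)) * e - w * (s * e).
Proof.
move=> u0 e0; rewrite expr_div_n -exprM exprS.
by field; rewrite e0 u0 expf_neq0.
Qed.

Lemma mulr_div_cancel (F : fieldType) (a b e p : F) : a != 0 -> b != 0 ->
  e * p = a / b * (e * (b / a) * p).
Proof. by move=> a0 b0; field; rewrite a0 b0. Qed.

Lemma mulr_cross_cancel (F : fieldType) (c a w e b : F) : e != 0 -> b != 0 ->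
  c * a * (w / e) * e = a * b * (c * (w / b)).
Proof. by move=> e0 b0; field; rewrite e0 b0. Qed.

(** * Inversion of the q-Faulhaber identity *)

Section FaulhaberInversion.
Variables (P : nat -> nat -> Zq) (m : nat).
Hypothesis hP : qFaulhaber P.

Definition faulhaber_coef k : Fq :=
  (-1) ^+ (m - k) * (qfact k / qfact m.+1) * tofrac (P m (m - k)%N).

(** The case n = 0 lies outside [qFaulhaber] but holds because [0] = 0; it starts the differences in
    n. *)
Lemma qS_odd_qX n :
  qS_odd m n * qint 2 = qF ^+ (m.+1 * n) *
    \sum_(k < m.+1) faulhaber_coef k * qX n ^+ k.+1.
Proof.
have q2 : qint 2 != 0 by exact: qint_neq0.
case: n => [|n].
  rewrite /qS_odd big_geq // mul0r big1 ?mulr0 // => k _.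
  by rewrite /qX /qint expr0 subrr !mul0r exprS mul0r mulr0.
rewrite hP // mulr_suml mulr_sumr big_mkord; apply: eq_bigr => k _.
rewrite -/(faulhaber_coef k).
have /= ltkm := ltn_ord k.
have -> : (m.+1 * n.+1 = (m - k) * n.+1 + n.+1 * k.+1)%N.
  by rewrite [(n.+1 * _)%N]mulnC -mulnDl; congr muln; lia.
rewrite exprD [in RHS](exprM _ n.+1) /qX expr_div_n.
exact: (mulr_cross_cancel _ _ _ q2 (expf_neq0 _ (expf_neq0 _ qF_neq0))).
Qed.

Lemma qY_phi n :
  qY n.+1 ^+ m =
  \sum_(k < m.+1) faulhaber_coef k * (map_poly (@tofrac _) (phi k)).[qY n.+1].
Proof.
have q2 : qint 2 != 0 by exact: qint_neq0.
have qd : qX n.+1 - qX n != 0.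
  rewrite qX_diff (_ : 2 * n.+1 = (2 * n).+2)%N; last by lia.
  exact: (mulf_neq0 (qint_neq0 _) (invr_neq0 (expf_neq0 _ qF_neq0))).
apply: (mulfI qd); rewrite mulr_sumr.
rewrite (eq_bigr (fun k : 'I_m.+1 => faulhaber_coef k * qX n.+1 ^+ k.+1
                              - faulhaber_coef k * qX n ^+ k.+1)); last first.
  by move=> k _; rewrite mulrCA (horner_phi _ (qX_sum n) (qX_prod n)) mulrBr.
rewrite sumrB.
have qn0 i : qF ^+ i != 0 by exact: (expf_neq0 _ qF_neq0).
(* After this scaling, the right side is [2] (S_(2m+1,n+1) - q^(m+1) S_(2m+1,n)), which is the last
   term of the sum times [2]. *)
apply: (mulfI (qn0 (m.+1 * n.+1)%N)); rewrite mulrBr -qS_odd_qX.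
rewrite [in RHS]mulnS [in RHS]exprD -[X in _ = _ - X]mulrA -qS_odd_qX qS_oddS qX_diff.
rewrite mulnC exprM /qY.
exact: (telescoping_identity _ _ _ _ _ (qn0 _) q2).
Qed.

Lemma faulhaber_coef_inv (l : nat) :
  \sum_(k < m.+1) faulhaber_coef k * tofrac (phi_coef k l) = (l == m)%:R.
Proof.
have /eqP : 'X^m - \sum_(k < m.+1) faulhaber_coef k *: map_poly (@tofrac _) (phi k) = 0.
  apply: (poly_eq0_inj qY_inj) => n; rewrite hornerD hornerN hornerXn horner_sum.
  by rewrite qY_phi; apply/eqP; rewrite subr_eq0; apply/eqP/eq_bigr => k _; rewrite hornerZ.
rewrite subr_eq0 => /eqP/(congr1 (fun p : {poly Fq} => p`_l)).
rewrite coefXn coef_sum => ->; apply: eq_bigr => k _.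
by rewrite coefZ coef_map coef_phi.
Qed.

Lemma qfact_prod n r : qfact (n + r)%N = qfact n * \prod_(i < r) qint (n + i).+1.
Proof.
elim: r => [|r IH]; first by rewrite addn0 big_ord0 mulr1.
by rewrite addnS big_ord_recr /= mulrA -IH /qfact big_nat_recr.
Qed.

Lemma qfact_neq0 n : qfact n != 0.
Proof.
by rewrite -[n]add0n qfact_prod /qfact big_geq // mul1r; apply/prodf_neq0 => i _; exact: qint_neq0.
Qed.

(* Cramer's rule for the lower triangular system of faulhaber_coef_inv,
   restricted to the rows and columns m - r, ..., m. *)
Lemma faulhaber_det r : (r <= m)%N ->
  P m r = \det (\matrix_(i < r, j < r)
            h1q (m%:Z - r%:Z - i%:Z + 2 * j%:Z - 1) (i%:Z - j%:Z + 2)).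
Proof.
move=> lerm; pose s := (m - r)%N.
pose M : 'M[Zq]_r.+1 := \matrix_(i, j) phi_coef (s + i)%N (s + j)%N.
pose MF : 'M[Fq]_r.+1 := map_mx (@tofrac _) M.
pose v : 'rV[Fq]_r.+1 := \row_i faulhaber_coef (s + i)%N.
have vM : v *m MF = delta_mx 0 ord_max.
  apply/rowP => j; rewrite !mxE eqxx /=.
  have -> : (j == ord_max) = (s + j == m)%N by rewrite -val_eqE /= /s; lia.
  rewrite -faulhaber_coef_inv -(big_mkord xpredT (fun k => faulhaber_coef k * tofrac (phi_coef k (s + j)%N))).
  rewrite (@big_cat_nat _ _ _ s) //=; last by rewrite /s; lia.
  (* Restricting to indices from s on loses nothing: [phi_coef k l] is 0 for k < l. *)
  rewrite [X in _ = X + _]big_nat [X in _ = X + _]big1 ?add0r; last first.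
    by move=> i /andP[_ lti]; rewrite phi_coef_gt ?tofrac0 ?mulr0 //; lia.
  rewrite -{1}[s]add0n big_addn (_ : m.+1 - s = r.+1)%N; last by rewrite /s; lia.
  by rewrite big_mkord; apply: eq_bigr => i _; rewrite !mxE addnC.
have detM : \det MF = qfact m.+1 / qfact s.
  rewrite det_trig; last first.
    apply/is_trig_mxP => i j ltij; rewrite !mxE phi_coef_gt ?tofrac0 //; lia.
  rewrite (_ : m.+1 = s + r.+1)%N; last by rewrite /s; lia.
  rewrite qfact_prod mulrC mulKf ?qfact_neq0 //; apply: eq_bigr => i _.
  (* The diagonal entry in position s + i is h_(s+i)({1,q}) = [s+i+1]. *)
  rewrite !mxE qintE /phi_coef; congr tofrac.
  by rewrite -h1q1; congr h1q; lia.
(* Entry 0 equates the first unknown times the determinant with the cofactor at row 0 and the last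
   column, whose sign (-1)^r matches that of [faulhaber_coef s]. *)
have := congr1 (fun w => (w *m \adj MF) 0 0) vM.
rewrite -mulmxA mul_mx_adj mul_mx_scalar mxE -rowE !mxE detM /faulhaber_coef.
rewrite addn0 (_ : m - s = r)%N; last by rewrite /s; lia.
rewrite /cofactor add0n /=.
have -> : row' 0 (col' ord_max MF) = map_mx (@tofrac _) (\matrix_(i < r, j < r)
            h1q (m%:Z - r%:Z - i%:Z + 2 * j%:Z - 1) (i%:Z - j%:Z + 2)).
  apply/matrixP => i j; rewrite !mxE lift0 lift_max; congr tofrac.
  by rewrite /phi_coef; congr h1q; rewrite /s; lia.
rewrite det_map_mx => E; apply/eqP; rewrite -tofrac_eq; apply/eqP.
apply: (mulfI (negbT (signr_eq0 _ r))); rewrite -[RHS]E.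
exact: (mulr_div_cancel _ _ (qfact_neq0 _) (qfact_neq0 _)).
Qed.

End FaulhaberInversion.

Theorem theorem6 (P : nat -> nat -> {poly int}) (hP : qFaulhaber P)
    (m k : nat) (hkm : (k <= m)%N) :
  P m k = \det (\matrix_(i < k, j < k)
            h1q (m%:Z - k%:Z - i%:Z + 2 * j%:Z - 1) (i%:Z - j%:Z + 2))
  /\
  \det (\matrix_(i < k, j < k)
     h1q (m%:Z - k%:Z - i%:Z + 2 * j%:Z - 1) (i%:Z - j%:Z + 2))
  = nonint_sum (fun j : 'I_k => (2 * j%:Z, - (2 * j%:Z)))
             (fun j : 'I_k => (2 * j%:Z + 3, m%:Z - k%:Z - 1 - j%:Z)).
Proof.
split; first exact: faulhaber_det.
rewrite -det_h1q_nonint; last by lia.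
by congr (\det _); apply/matrixP => i j; rewrite !mxE; congr h1q; lia.
Qed.
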